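(* Let $n=4$ or $n=6$, let $m_1,m_2\geq1$ be integers, and let $k_1,k_2$ be integers such that $\gcd(m_1,k_1)=1$ and $\gcd(m_2,k_2)=1$. Then $J_n(m_1,k_1)\cong J_n(m_2,k_2)$ if and only if $m_1=m_2$ and either $k_1\equiv k_2$ mod $n$ or $k_1+k_2\equiv m_1$ mod $n$.
   Context: For integers $m,k$, $J_n(m,k)$ denotes the group with presentation $\langle t,y\mid t^n,\ y^{m-k}t^3y^kt^2\rangle$. *)

(* Defs.v *)
From HB Require Import structures.
From mathcomp Require Import all_boot all_order all_algebra.
From mathcomp Require Import boolp.

Set Implicit Arguments.
Unset Strict Implicit.
Unset Printing Implicit Defensive.

(* The letter (x, false) stands for x and (x, true) for x^-1. *)
Definition word (X : Type) := seq (X * bool).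

Definition winv (X : Type) (w : word X) : word X :=
  rev [seq (l.1, ~~ l.2) | l <- w].

Definition wexpn (X : Type) (w : word X) (n : nat) : word X :=
  flatten (nseq n w).

Definition wexpz (X : Type) (w : word X) (z : int) : word X :=
  match z with
  | Posz n => wexpn w n
  | Negz n => wexpn (winv w) n.+1
  end.

Section Presentation.

Variables (X : choiceType) (R : seq (word X)).

Inductive wcongr : word X -> word X -> Prop :=
  | wcongr_refl u : wcongr u u
  | wcongr_sym u v : wcongr u v -> wcongr v u
  | wcongr_trans u v w : wcongr u v -> wcongr v w -> wcongr u w
  | wcongr_cat u u' v v' :
      wcongr u u' -> wcongr v v' -> wcongr (u ++ v) (u' ++ v')
  | wcongr_cancel x b : wcongr [:: (x, b); (x, ~~ b)] [::]
  | wcongr_rel r : r \in R -> wcongr r [::].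

Definition wcongrb (u v : word X) : bool := `[< wcongr u v >].

Lemma wcongrb_is_equiv : equiv_class_of wcongrb.
Proof.
split=> [u | u v | v u w].
- by apply/asboolP; apply: wcongr_refl.
- by apply/asboolP/asboolP; apply: wcongr_sym.
- by move=> /asboolP uv /asboolP vw; apply/asboolP; apply: wcongr_trans vw.
Qed.

Canonical wcongrb_equiv := EquivRelPack wcongrb_is_equiv.

(* The group < X | R >, as words modulo the congruence generated by the       *)
(* cancellations x x^-1 = x^-1 x = 1 and the relations r = 1 for r in R.      *)
Definition presented := {eq_quot wcongrb_equiv}%qT.

HB.instance Definition _ : EqQuotient _ wcongrb_equiv presented :=
  EqQuotient.on presented.
HB.instance Definition _ := Choice.on presented.

Definition word_class (u : word X) : presented := (\pi u)%qT.

Lemma word_classP (u v : word X) : word_class u = word_class v <-> wcongr u v.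
Proof.
split=> [/eqmodP /asboolP // | uv]; by apply/eqmodP/asboolP.
Qed.

Lemma word_class_repr (a : presented) : word_class (repr a) = a.
Proof. exact: reprK. Qed.

Definition presented_mul (a b : presented) : presented :=
  word_class (repr a ++ repr b).
Definition presented_one : presented := word_class [::].
Definition presented_inv (a : presented) : presented :=
  word_class (winv (repr a)).

Lemma word_class_cat (u v : word X) :
  word_class (u ++ v) = presented_mul (word_class u) (word_class v).
Proof.
apply/word_classP/wcongr_cat; apply/wcongr_sym/word_classP; exact: word_class_repr.
Qed.

Lemma winvK (u : word X) : winv (winv u) = u.
Proof.
rewrite /winv map_rev revK -map_comp -[RHS]map_id.
by apply: eq_map => -[x b] /=; rewrite negbK.
Qed.

Lemma wcongr_mulwV (u : word X) : wcongr (u ++ winv u) [::].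
Proof.
elim: u => [|[x b] u IHu]; first exact: wcongr_refl.
have -> : ((x, b) :: u) ++ winv ((x, b) :: u)
           = [:: (x, b)] ++ ((u ++ winv u) ++ [:: (x, ~~ b)]).
  by rewrite /winv /= rev_cons -cats1 catA.
apply: (wcongr_trans _ (wcongr_cancel x b)).
apply: (@wcongr_cat _ [:: (x, b)] _ [:: (x, ~~ b)]); first exact: wcongr_refl.
exact: wcongr_cat IHu (wcongr_refl _).
Qed.

Lemma presented_mulA : associative presented_mul.
Proof.
move=> a b c; rewrite -(word_class_repr a) -(word_class_repr b).
by rewrite -(word_class_repr c) -!word_class_cat catA.
Qed.

Lemma presented_mul1g : left_id presented_one presented_mul.
Proof. by move=> a; rewrite -(word_class_repr a) -word_class_cat. Qed.

Lemma presented_mulg1 : right_id presented_one presented_mul.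
Proof. by move=> a; rewrite -(word_class_repr a) -word_class_cat cats0. Qed.

Lemma presented_mulVg : left_inverse presented_one presented_inv presented_mul.
Proof.
move=> a; rewrite -[X in presented_mul _ X](word_class_repr a) -word_class_cat.
by apply/word_classP; rewrite -[X in _ ++ X]winvK; apply: wcongr_mulwV.
Qed.

Lemma presented_mulgV : right_inverse presented_one presented_inv presented_mul.
Proof.
move=> a; rewrite -{1}(word_class_repr a) -word_class_cat.
by apply/word_classP; apply: wcongr_mulwV.
Qed.

HB.instance Definition _ := isGroup.Build presented
  presented_mulA presented_mul1g presented_mulg1 presented_mulVg presented_mulgV.

End Presentation.

Inductive J_gen := J_t | J_y.

Definition J_gen_code (g : J_gen) : bool := if g is J_t then true else false.
Definition J_gen_decode (b : bool) : J_gen := if b then J_t else J_y.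
Lemma J_gen_codeK : cancel J_gen_code J_gen_decode. Proof. by case. Qed.
HB.instance Definition _ := Countable.copy J_gen (can_type J_gen_codeK).

Definition J_relators (n : nat) (m k : int) : seq (word J_gen) :=
  let t := [:: (J_t, false)] in
  let y := [:: (J_y, false)] in
  [:: wexpn t n;
      wexpz y (m - k)%R ++ wexpn t 3 ++ wexpz y k ++ wexpn t 2].

Definition J (n : nat) (m k : int) : groupType := presented (J_relators n m k).

Definition isomorphic (G H : groupType) : Prop :=
  exists f : {multiplicative G -> H}, bijective f.

(* Main.v *)
(* Write J(m,k) for J_n(m,k).  As y^m commutes with p = y^k, the relation
   t^3 p t^2 y^m = p makes y^m the image of an elliptic element of a Euclidean
   triangle group ((2,4,4) or (2,3,6)), whence y^(mn) = 1.  So k matters only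
   modulo mn, and replacing y by a suitable power y^s with s = 1 mod n changes k
   by any multiple of n; inverting t and y exchanges k with m - k.

   Conversely, the abelianization is cyclic of order mn, generated by y, which
   recovers m.  Let w be a primitive n-th root of unity.  The action of J(m,k)
   on its commutator subgroup yields an affine representation over Z[w]/(a_k),
   where a_k = w^(7k) (w^3 (1 + w))^m - (-(1 + w + w^2))^m, in which t acts as
   v |-> w v + 1 and y as multiplication by an m-th root of w^7 = w^-5.  An
   isomorphism J(m,k1) -> J(m,k2) turns this into a representation of J(m,k1)
   that sends t to a map of slope w or w^-1, the only primitive n-th roots of
   unity for n = 4, 6, and then a_k2 divides a_k1 or its conjugate.  By symmetry
   the norms of a_k1 and a_k2 agree, and comparing traces gives the claim. *)
Require Import Defs.
From HB Require Import structures.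
From mathcomp Require Import all_boot all_order all_algebra.
From mathcomp Require Import generic_quotient ring_quotient boolp zify ring.

Set Implicit Arguments.
Unset Strict Implicit.
Unset Printing Implicit Defensive.

Local Open Scope group_scope.

(** * The order of y^m, from Euclidean triangle groups *)

Definition group_simp (G : groupType) :=
  (@invgM G, @invgK G, @mulgA G, @mulgK G, @mulgVK G, @mulVg G, @mulgV G,
   @mul1g G, @mulg1 G).

(** Read as two conjugations by [p], the relation makes [Y * b] and [a * Y] conjugate to [a^-1] and
    [b^-1]. With powers of t for [a] and [b], they satisfy the same torsion relations. *)
Lemma conjg_relator (G : groupType) (a b p Y : G) : commute p Y ->
  b * p * a * Y = p -> a ^ p^-1 = (Y * b)^-1 /\ b ^ p = (a * Y)^-1.
Proof.
move=> pY rel; rewrite !conjgE; split.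
  have /(congr1 (fun z => b^-1 * z * Y^-1)) := rel; rewrite !group_simp => e.
  by rewrite e -!mulgA -[Y^-1 * _]invgM pY !group_simp.
have /(congr1 (fun z => p^-1 * z * Y^-1 * a^-1)) := rel.
by rewrite !group_simp.
Qed.

Section CommutingPowerOrder.

Variables (G : groupType) (t p Y : G).
Hypothesis pY : commute p Y.
Hypothesis rel : t ^+ 3 * p * t ^+ 2 * Y = p.

Let t2E : (t ^+ 2) ^ p^-1 = (Y * t ^+ 3)^-1.
Proof. by case: (conjg_relator pY rel). Qed.

Let t3E : (t ^+ 3) ^ p = (t ^+ 2 * Y)^-1.
Proof. by case: (conjg_relator pY rel). Qed.

(** The involution Y t^3, conjugate to t^-2, turns t^2 Y into a conjugate of Y^-1, while t^2 Y is
    itself conjugate to t^-3 and so killed by 4. *)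
Lemma commuting_power_order4 : t ^+ 4 = 1 -> Y ^+ 4 = 1.
Proof.
move=> t4.
have tV : t ^+ 3 = t^-1 by apply: (mulgI t); rewrite -expgS t4 mulgV.
have h1 : Y * t^-1 * Y = t.
  have : (Y * t ^+ 3) ^+ 2 = 1.
    apply: invg_inj; rewrite -expVgn -t2E -conjXg -expgnA.
    by rewrite (expgnA t 4 1) t4 conj1g invg1.
  by rewrite tV expg2 => /(congr1 (fun z => z * t)); rewrite !group_simp.
have h2 : (t ^+ 2 * Y) ^+ 4 = 1.
  apply: invg_inj; rewrite -expVgn -t3E -conjXg -expgnA.
  by rewrite (expgnA t 4 3) t4 expg1n conj1g invg1.
have YV : Y^-1 = t^-1 * Y * t^-1.
  by apply: (mulgI (Y * t^-1 * Y)); rewrite {2}h1 !group_simp.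
have e : t ^+ 2 * Y = Y^-1 ^ t.
  rewrite YV conjgE !group_simp; congr (_ * _).
  by apply: (mulIg (t ^+ 2)); rewrite -expgnDr t4 expg2 !group_simp.
by move: h2; rewrite e -conjXg expVgn => /eqP; rewrite conjg_eq1 invg_eq1 => /eqP.
Qed.

(* With T j := t^j (Y t^-1) t^-j one has Y^6 = T 0 T 1 ... T 5, and the T j are
   the translations of a quotient of the Euclidean triangle group (2, 3, 6). *)
Lemma commuting_power_order6 : t ^+ 6 = 1 -> Y ^+ 6 = 1.
Proof.
move=> t6.
have h1 : (Y * t ^+ 3) ^+ 3 = 1.
  apply: invg_inj; rewrite -expVgn -t2E -conjXg -expgnA.
  by rewrite (expgnA t 6 1) t6 conj1g invg1.
have h2 : (t ^+ 2 * Y) ^+ 2 = 1.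
  apply: invg_inj; rewrite -expVgn -t3E -conjXg -expgnA.
  by rewrite (expgnA t 6 1) t6 conj1g invg1.
have tV i j : (i + j = 6)%N -> t ^- i = t ^+ j.
  by move=> e; apply: (mulgI (t ^+ i)); rewrite mulgV -expgnDr e t6.
pose T j := t ^+ j * Y * t ^- j.+1.
have TJ j : T j.+1 = T j ^ t^-1.
  by rewrite /T conjgE invgK (expgS t j.+1) invgM (expgS t j) !mulgA.
(* Opposite translations cancel by [h2]; by [h1], so do three translations at mutual angles of 120
   degrees ([tri]). *)
have opp j : T (3 + j)%N * T j = 1.
  elim: j => [|j IHj]; last by rewrite addnS (TJ (3 + j)%N) (TJ j) -conjMg IHj conj1g.
  rewrite addn0 /T (tV 4 2) // expg0 mul1g expg1 expgS.
  move: h2; rewrite expg2; move: (t ^+ 2) => a h2.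
  by have := congr1 (fun z => t * z * t^-1) h2; rewrite mulg1 mulgV !mulgA.
have tri j : T j * T (4 + j)%N * T (2 + j)%N = 1.
  elim: j => [|j IHj]; last first.
    rewrite !addnS (TJ j) (TJ (4 + j)%N) (TJ (2 + j)%N).
    by rewrite -!conjMg IHj conj1g.
  have cube z : z ^+ 3 = z * (z * z) :> G by [].
  have e4 : t ^+ 4 = t * t ^+ 3 by rewrite expgS.
  have e3 : t ^+ 3 = t * t ^+ 2 by rewrite expgS.
  rewrite -h1 cube /T !addn0 expg0 mul1g expg1 (tV 5 1)%N // (tV 3 3)%N // expg1.
  move: e4 e3; move: (t ^+ 4) (t ^+ 3) (t ^+ 2) => d c b -> {4}->.
  by rewrite !mulgA mulgVK.
have TE j : T j * t ^+ j.+1 = t ^+ j * Y by rewrite /T mulgVK.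
clearbody T => {TJ}.
have T0 : T 3 = (T 0)^-1 by rewrite -(mulg1_eq (opp 0)) invgK.
have T1 : T 4 = (T 1%N)^-1 by rewrite -(mulg1_eq (opp 1%N)) invgK.
have T2 : T 5 = (T 2)^-1 by rewrite -(mulg1_eq (opp 2)) invgK.
have tri0 : T 0 * T 4 * T 2 = 1 := tri 0.
have tri1 : T 1%N * T 5 * T 3 = 1 := tri 1%N.
(* Inverting [tri1] gives T 0 T 2 T 4 = 1, to be compared with [tri0]. *)
have com : T 2 * T 4 = T 4 * T 2.
  apply: (mulgI (T 0)); rewrite !mulgA tri0.
  by apply: invg_inj; rewrite invg1 -tri1 T0 T2 T1 !invgM invgK mulgA.
have step j Q : Y ^+ j = Q * t ^+ j -> Y ^+ j.+1 = Q * T j * t ^+ j.+1.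
  by move=> e; rewrite expgSr e -!mulgA TE.
have -> : Y ^+ 6 = T 0 * T 1%N * T 2 * T 3 * T 4 * T 5 * t ^+ 6.
  by do 5!apply: (step); rewrite TE expg0 mul1g.
rewrite t6 mulg1 T0 T2 -[T 1%N]invgK -T1.
have -> : T 0 = (T 2)^-1 * (T 4)^-1.
  by apply: (mulIg (T 4 * T 2)); rewrite mulgA tri0 !group_simp.
rewrite !group_simp -[_ * T 2 * T 4]mulgA com !group_simp.
by do 2!rewrite -[_ * T 2 * T 4]mulgA com !group_simp.
Qed.

End CommutingPowerOrder.

(** * Homomorphisms out of presented groups *)

Section WordEvaluation.

Variables (X : choiceType) (G : groupType) (f : X -> G).

Definition weval (w : word X) : G :=
  \prod_(l <- w) if l.2 then (f l.1)^-1 else f l.1.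

Lemma weval_cat u v : weval (u ++ v) = weval u * weval v.
Proof. exact: big_cat. Qed.

Lemma weval1 x b : weval [:: (x, b)] = if b then (f x)^-1 else f x.
Proof. exact: big_seq1. Qed.

Lemma weval_winv w : weval (winv w) = (weval w)^-1.
Proof.
elim: w => [|[x b] w IHw]; first by rewrite /weval /winv big_nil invg1.
rewrite -cat1s weval_cat weval1 invgM -IHw.
have -> : winv ([:: (x, b)] ++ w) = winv w ++ [:: (x, ~~ b)].
  by rewrite /winv /= rev_cons cats1.
by rewrite weval_cat weval1; case: b; rewrite /= ?invgK.
Qed.

Lemma weval_wexpn w n : weval (wexpn w n) = weval w ^+ n.
Proof.
elim: n => [|n IHn]; first by rewrite /weval /wexpn big_nil.
by rewrite expgS -IHn -weval_cat.
Qed.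

Variable R : seq (word X).
Hypothesis fR : forall r, r \in R -> weval r = 1.

Lemma weval_wcongr u v : wcongr R u v -> weval u = weval v.
Proof.
elim=> // [a b c _ -> _ -> //|a a' b b' _ e _ e'|x b|r rR].
- by rewrite !weval_cat e e'.
- rewrite (weval_cat [:: _] [:: _]) !weval1 /weval big_nil.
  by case: b; rewrite /= ?mulVg ?mulgV.
- by rewrite fR // /weval big_nil.
Qed.

Definition presented_lift (a : presented R) : G := weval (repr a).

Lemma presented_lift_class w : presented_lift (word_class R w) = weval w.
Proof. exact/weval_wcongr/word_classP/word_class_repr. Qed.

Fact presented_lift_mul : {morph presented_lift : a b / a * b}.
Proof. by move=> a b; rewrite presented_lift_class weval_cat. Qed.

HB.instance Definition _ :=
  isMultiplicative.Build (presented R) G presented_lift presented_lift_mul.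

Lemma presented_liftP : exists F : {multiplicative presented R -> G},
  forall x, F (word_class R [:: (x, false)]) = f x.
Proof.
by exists presented_lift => x; rewrite /= presented_lift_class weval1.
Qed.

End WordEvaluation.

Section PresentedGroup.

Variables (X : choiceType) (R : seq (word X)).

Definition presented_gen (x : X) : presented R := word_class R [:: (x, false)].

Lemma word_class_cons x b w :
  word_class R ((x, b) :: w) =
    (if b then (presented_gen x)^-1 else presented_gen x) * word_class R w.
Proof.
rewrite -cat1s word_class_cat; congr (_ * _); case: b => //.
apply/esym/mulg1_eq; rewrite -[_ * _]word_class_cat.
exact/word_classP/wcongr_cancel.
Qed.

Lemma word_class_weval w : word_class R w = weval presented_gen w.
Proof.
elim: w => [|[x b] w IHw]; first by rewrite /weval big_nil.
by rewrite word_class_cons IHw [RHS]big_cons.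
Qed.

Lemma weval_presented_gen r : r \in R -> weval presented_gen r = 1.
Proof.
by move=> rR; rewrite -word_class_weval; apply/word_classP/wcongr_rel.
Qed.

Lemma presented_ind (P : presented R -> Prop) :
    P 1 -> (forall x g, P g -> P (presented_gen x * g)) ->
    (forall x g, P g -> P ((presented_gen x)^-1 * g)) ->
  forall g, P g.
Proof.
move=> P1 PM PV g; rewrite -(word_class_repr g).
elim: (repr g) => [//|[x b] w IHw].
by rewrite word_class_cons; case: b; [apply: PV | apply: PM].
Qed.

End PresentedGroup.

(** * Integer powers *)

Definition zexpg (G : groupType) (y : G) (z : int) : G :=
  match z with Posz n => y ^+ n | Negz n => y ^- n.+1 end.

Section IntegerPowers.

Variables (G : groupType) (y : G).

Lemma weval_wexpz (X : choiceType) (f : X -> G) w z :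
  weval f (wexpz w z) = zexpg (weval f w) z.
Proof.
case: z => n; rewrite /= weval_wexpn //.
by rewrite weval_winv expVgn.
Qed.

Lemma zexpgMX z i j : (z + i%:Z = j%:Z)%R -> zexpg y z * y ^+ i = y ^+ j.
Proof.
case: z => n /= e; first by rewrite -expgnDr; congr (_ ^+ _); lia.
have -> : i = (n.+1 + j)%N by lia.
by rewrite expgnDr mulKg.
Qed.

Lemma zexpgM z1 z2 i : (z1 + z2 = i%:Z)%R -> zexpg y z1 * zexpg y z2 = y ^+ i.
Proof.
move=> e; pose a := `|(z2 + `|z2|%N%:Z)%R|%N.
have e1 : (z2 + `|z2|%N%:Z = a%:Z)%R by rewrite /a; lia.
have e2 : (z1 + a%:Z = (i + `|z2|)%N%:Z)%R by rewrite PoszD; lia.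
apply: (mulIg (y ^+ `|z2|)).
by rewrite -expgnDr -mulgA (zexpgMX e1) (zexpgMX e2).
Qed.

Lemma commute_zexpg z : commute (zexpg y z) y.
Proof.
apply: commute_sym; case: z => n; last apply: commuteV.
  exact/commuteX/commute_refl.
exact/commuteX/commute_refl.
Qed.

Lemma zexpg_mod d z : (0 < d)%N -> y ^+ d = 1 ->
  zexpg y z = y ^+ `|(z %% d)%Z|.
Proof.
move=> d0 yd; set q := (z %/ d)%Z.
have r0 : (0 <= z %% d)%Z%R by rewrite modz_ge0 // -lt0n.
have y1 i : y ^+ (i * d) = 1 by rewrite mulnC expgnA yd expg1n.
rewrite -[LHS]mulg1 -(y1 `|q|%N).
rewrite (@zexpgMX _ _ (`|(z %% d)%Z| + `|(q + `|q|%N%:Z)%R| * d)).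
  by rewrite expgnDr y1 mulg1.
rewrite {1}(divz_eq z d) -/q; move: r0; set r := (z %% d)%Z => r0.
have -> : ((`|r| + `|(q + `|q|%N%:Z)%R| * d)%N%:Z = r + (q + `|q|%N%:Z) * d%:Z)%R.
  by rewrite PoszD PoszM gez0_abs // gez0_abs //; lia.
by rewrite PoszM; lia.
Qed.

End IntegerPowers.

(** * The presentation of J_n(m,k) without inverses *)

(* The defining relations of J_n(m,k), rearranged so that for k a natural
   number no inverses occur. *)
Definition Jpair (n m k : nat) (G : groupType) (t y : G) : Prop :=
  t ^+ n = 1 /\ t ^+ 3 * y ^+ k * t ^+ 2 * y ^+ m = y ^+ k.

(** [p] is left general so as to cover both y^k for an integer k and y^K for its residue K modulo m
    n. *)
Lemma Jpair_order (n m : nat) (G : groupType) (t y p : G) :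
    n = 4 \/ n = 6 -> commute p y -> t ^+ n = 1 ->
  t ^+ 3 * p * t ^+ 2 * y ^+ m = p -> y ^+ (m * n) = 1.
Proof.
move=> hn py tn e; rewrite expgnA; have pY := commuteX m py.
case: hn tn => -> tn.
  exact: commuting_power_order4 pY e tn.
exact: commuting_power_order6 pY e tn.
Qed.

Definition J_of (n : nat) (m k : int) (x : J_gen) : J n m k :=
  presented_gen (J_relators n m k) x.

Section JPresentation.

Variables (n m : nat) (k : int).
Hypothesis hn : n = 4 \/ n = 6.
Hypothesis m0 : (0 < m)%N.

Let K := `|(k %% (m * n)%N)%Z|%N.

(** Replacing [k] by its residue [K] is legitimate in both directions because either form of the
    relations already forces y^(m n) = 1. *)
Lemma weval_J_relators (G : groupType) (f : J_gen -> G) :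
  (forall r, r \in J_relators n m k -> weval f r = 1) <->
  Jpair n m K (f J_t) (f J_y).
Proof.
pose t := f J_t; pose y := f J_y; pose p := zexpg y k.
have py : commute p y by apply: commute_zexpg.
have pY := commuteX m py.
have qE : zexpg y (m%:Z - k)%R * p = y ^+ m.
  by apply: zexpgM; lia.
have relE : weval f (wexpz [:: (J_y, false)] (m%:Z - k)%R ++ wexpn [:: (J_t, false)] 3 ++
    wexpz [:: (J_y, false)] k ++ wexpn [:: (J_t, false)] 2) =
    zexpg y (m%:Z - k)%R * (t ^+ 3 * (p * t ^+ 2)).
  rewrite (weval_cat f (wexpz _ _)) (weval_cat f (wexpn _ 3)).
  by rewrite (weval_cat f (wexpz _ k)) 2!weval_wexpn 2!weval_wexpz !weval1.
have tnE : weval f (wexpn [:: (J_t, false)] n) = t ^+ n by rewrite weval_wexpn weval1.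
have n0 : (0 < m * n)%N by case: hn => ->; lia.
have eqE : zexpg y (m%:Z - k)%R * (t ^+ 3 * (p * t ^+ 2)) = 1 <->
    t ^+ 3 * p * t ^+ 2 * y ^+ m = p.
  move: (t ^+ 3) (t ^+ 2) (y ^+ m) (zexpg y _) pY qE => b a Y q pY qE.
  have -> : q = Y * p^-1 by rewrite -qE mulgK.
  split=> e.
    have /(congr1 (fun z => p * Y^-1 * z * Y)) := e.
    by rewrite !group_simp.
  have /(congr1 (fun z => Y * p^-1 * z * Y^-1)) := e.
  by rewrite !group_simp.
split=> [h|[tn e] r].
  have tn : t ^+ n = 1 by rewrite -tnE h // mem_head.
  have /eqE e : zexpg y (m%:Z - k)%R * (t ^+ 3 * (p * t ^+ 2)) = 1.
    by rewrite -relE h // !inE eqxx orbT.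
  split=> //; rewrite -!(zexpg_mod k n0) //.
  exact: Jpair_order e.
have yo := Jpair_order hn (commute_sym (commuteX K (commute_refl y))) tn e.
rewrite -/y -(zexpg_mod k n0 yo) in e.
by rewrite !inE => /orP[] /eqP ->; [rewrite tnE | rewrite relE; apply/eqE].
Qed.

Local Notation t := (J_of n m k J_t).
Local Notation y := (J_of n m k J_y).

Lemma Jpair_J : Jpair n m K t y.
Proof. by apply/(weval_J_relators (J_of n m k)) => r; apply: weval_presented_gen. Qed.

Lemma J_lift (G : groupType) (a b : G) : Jpair n m K a b ->
  exists F : {multiplicative J n m k -> G}, F t = a /\ F y = b.
Proof.
pose f x := if x is J_t then a else b.
by move=> /(weval_J_relators f) /presented_liftP[F FE]; exists F; split; apply: FE.
Qed.

Lemma J_order : y ^+ (m * n) = 1.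
Proof.
have [tn e] := Jpair_J.
exact: Jpair_order hn (commute_sym (commuteX K (commute_refl _))) tn e.
Qed.

(** Both generators have finite order, so their inverses are positive powers. *)
Lemma J_ind (P : J n m k -> Prop) :
    P 1 -> (forall g, P g -> P (t * g)) -> (forall g, P g -> P (y * g)) ->
  forall g, P g.
Proof.
move=> P1 Pt Py.
have VX (z : J n m k) i : (0 < i)%N -> z ^+ i = 1 -> z^-1 = z ^+ i.-1.
  by case: i => // i _ zi; apply: (mulgI z); rewrite mulgV -expgS zi.
have PX (z : J n m k) i : (forall g, P g -> P (z * g)) ->
    forall g, P g -> P (z ^+ i * g).
  move=> Pz g Pg; elim: i => [|i IHi]; first by rewrite mul1g.
  by rewrite expgS -mulgA; apply: Pz.
have [tn _] := Jpair_J; have yd := J_order.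
have n0 : (0 < n)%N by case: hn => ->.
have d0 : (0 < m * n)%N by rewrite muln_gt0 m0.
apply: presented_ind => // -[|] g Pg; [exact: Pt | exact: Py | |].
  by rewrite (VX t n); [apply: PX | |].
by rewrite (VX y (m * n)%N); [apply: PX | |].
Qed.

Lemma group_morph1 (G H : groupType) (F : {multiplicative G -> H}) : F 1 = 1.
Proof. by apply: (mulgI (F 1)); rewrite -gmulfM !mulg1. Qed.

Lemma group_morphX (G H : groupType) (F : {multiplicative G -> H}) i :
  {morph F : g / g ^+ i}.
Proof.
move=> g; elim: i => [|i IHi]; first exact: group_morph1.
by rewrite !expgS gmulfM IHi.
Qed.

Lemma J_morph_eq (G : groupType) (F F' : {multiplicative J n m k -> G}) :
  F t = F' t -> F y = F' y -> F =1 F'.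
Proof.
move=> Ft Fy; apply: J_ind => [|g IH|g IH]; first by rewrite !group_morph1.
  by rewrite !gmulfM Ft IH.
by rewrite !gmulfM Fy IH.
Qed.

End JPresentation.

(** * Isomorphisms that change k *)

Section JIsomorphisms.

Variables (n m : nat).
Hypothesis hn : n = 4 \/ n = 6.
Hypothesis m0 : (0 < m)%N.

Lemma J_isomorphic k1 k2 (F : {multiplicative J n m k1 -> J n m k2})
    (F' : {multiplicative J n m k2 -> J n m k1}) :
  (forall x, F' (F (J_of n m k1 x)) = J_of n m k1 x) ->
  (forall x, F (F' (J_of n m k2 x)) = J_of n m k2 x) ->
  isomorphic (J n m k1) (J n m k2).
Proof.
move=> FK F'K; exists F; exists F'.
  exact: (J_morph_eq hn m0 (F := F' \o F) (F' := idfun)) (FK _) (FK _).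
exact: (J_morph_eq hn m0 (F := F \o F') (F' := idfun)) (F'K _) (F'K _).
Qed.

Let d := (m * n)%N.
Let K k := `|(k %% d)%Z|%N.

(** As y^m = y^k y^k', the relation says t^2 = y^-k t^-3 y^-k'. Its inverse is the same equation for
    t^-1 and y^-1 with [k] and [k'] exchanged. *)
Lemma Jpair_inv k k' (G : groupType) (t y : G) :
  Jpair n m k t y -> y ^+ (k + k') = y ^+ m -> Jpair n m k' t^-1 y^-1.
Proof.
move=> [tn e] ye; split; first by rewrite expVgn tn invg1.
have yy i j : y ^+ i * y ^+ j = y ^+ j * y ^+ i by rewrite -!expgnDr addnC.
move: ye; rewrite !expVgn expgnDr.
move: (yy k m) (yy k k') (yy m k') e.
move: (y ^+ k) (y ^+ k') (y ^+ m) (t ^+ 2) (t ^+ 3) => p p' Y a b pY pp' Yp' e ye.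
have aE : a = p^-1 * b^-1 * p'^-1.
  have /(congr1 (fun z => p^-1 * b^-1 * z * Y^-1)) := e; rewrite !group_simp => ->.
  by rewrite -ye pp' !group_simp.
by apply: invg_inj; rewrite !group_simp aE -ye pp' !group_simp.
Qed.

Lemma coprime_residue k : gcdz m k = 1%R -> coprime m (K k).
Proof.
move=> mk; have : gcdz m (k %% d)%Z = 1%R.
  rewrite -mk {2}(divz_eq k d) /d PoszM (GRing.mulrC (Posz m)).
  by rewrite GRing.mulrA gcdzMDl.
by rewrite /gcdz absz_nat -/(K k) => -[/eqP].
Qed.

Lemma expg_coprime_inj k (G : groupType) (z y : G) : coprime m k ->
  z ^+ m = y ^+ m -> z ^+ k = y ^+ k -> z = y.
Proof.
move=> mk zm zk; case: (egcdnP k m0) => u v uv _.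
rewrite (eqP mk) addn1 in uv.
have := erefl (z ^+ (u * m)); rewrite {1}uv expgSr (mulnC v) (mulnC u) !expgnA zm zk.
by rewrite -!expgnA (mulnC m) uv expgSr (mulnC v) => /mulgI.
Qed.

Lemma J_scale k1 k2 : gcdz m k2 = 1%R -> (k1 = k2 %[mod n])%Z ->
  exists s, forall (G : groupType) (t y : G), Jpair n m (K k1) t y ->
    [/\ Jpair n m (K k2) t (y ^+ s), y ^+ (s * K k2) = y ^+ K k1
      & y ^+ (s * m) = y ^+ m].
Proof.
move=> cop /eqP; rewrite eqz_mod_dvd => /dvdzP[j k1E].
have [u [v uv]] := Bezoutz m k2; rewrite cop in uv.
(* With v k2 = 1 modulo m and k1 = k2 + j n, the exponent s = 1 + n v j satisfies s k2 = k1 and s m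
   = m modulo m n. *)
exists (K (1 + n%:Z * v * j)%R) => G t y [tn e].
have yd : y ^+ d = 1.
  exact: Jpair_order (commute_sym (commuteX _ (commute_refl _))) tn e.
have y_mod (a b : nat) : (a%:Z = b %[mod d])%Z -> y ^+ a = y ^+ b.
  rewrite !modz_nat => -[ab].
  rewrite (divn_eq a d) (divn_eq b d) ab !expgnDr.
  by rewrite !(mulnC _ d) !(expgnA _ d) yd !expg1n.
have KE z : ((K z)%:Z = z %[mod d])%Z.
  by rewrite gez0_abs ?modz_mod // modz_ge0 //; lia.
have sk : y ^+ (K (1 + n%:Z * v * j)%R * K k2) = y ^+ K k1.
  apply: y_mod; rewrite PoszM -modzMm !KE modzMm; apply/eqP.
  rewrite eqz_mod_dvd; apply/dvdzP; exists (- u * j)%R.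
  have -> : k1 = (k2 + j * n%:Z)%R by rewrite -k1E; lia.
  have e' : (v * k2 = 1 - u * m%:Z)%R by rewrite -uv; lia.
  transitivity (j * n%:Z * (v * k2 - 1))%R; first by ring.
  by rewrite e' /d PoszM; ring.
have sm : y ^+ (K (1 + n%:Z * v * j)%R * m) = y ^+ m.
  apply: y_mod; rewrite PoszM -modzMml KE modzMml; apply/eqP.
  rewrite eqz_mod_dvd; apply/dvdzP; exists (v * j)%R.
  rewrite /d PoszM; lia.
by do 2!split=> //; rewrite -!expgnA sk sm.
Qed.

(** The two scalings are inverse to each other although their exponents are chosen independently:
    the composite preserves y^m and y^k, which determine y when m and k are coprime. *)
Lemma J_isomorphic_mod k1 k2 : gcdz m k1 = 1%R -> gcdz m k2 = 1%R ->
  (k1 = k2 %[mod n])%Z -> isomorphic (J n m k1) (J n m k2).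
Proof.
move=> cop1 cop2 k12.
have [s1 s1P] := J_scale cop1 (esym k12).
have [s2 s2P] := J_scale cop2 k12.
have [J1 E1 M1] := s2P _ _ _ (Jpair_J k1 hn m0).
have [J2 E2 M2] := s1P _ _ _ (Jpair_J k2 hn m0).
have [F' [F't F'y]] := J_lift hn m0 J1.
have [F [Ft Fy]] := J_lift hn m0 J2.
apply: (@J_isomorphic _ _ F F') => -[]; rewrite ?Ft ?F't //.
  have [_ e em] := s1P _ _ _ J1.
  rewrite Fy group_morphX F'y; apply: (expg_coprime_inj (coprime_residue cop1)).
    by rewrite -expgnA em -expgnA M1.
  by rewrite -expgnA e -expgnA E1.
have [_ e em] := s2P _ _ _ J2.
rewrite F'y group_morphX Fy; apply: (expg_coprime_inj (coprime_residue cop2)).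
  by rewrite -expgnA em -expgnA M2.
by rewrite -expgnA e -expgnA E2.
Qed.

Lemma J_isomorphic_flip k : isomorphic (J n m k) (J n m (m%:Z - k)).
Proof.
have yd k' := J_order k' hn m0.
have d0 : (0 < d)%N by case: hn => hn'; rewrite /d hn' muln_gt0 m0.
have eK (G : groupType) (y : G) k1 k2 : y ^+ d = 1 -> (k1 + k2 = m%:Z)%R -> 
    y ^+ (K k1 + K k2) = y ^+ m.
  move=> y1 e; rewrite expgnDr -!(zexpg_mod _ d0) //.
  exact: zexpgM.
have kE : (k + (m%:Z - k) = m%:Z)%R by lia.
have kE' : (m%:Z - k + k = m%:Z)%R by lia.
have J1 := Jpair_inv (Jpair_J k hn m0) (eK _ _ _ _ (yd k) kE).
have J2 := Jpair_inv (Jpair_J (m%:Z - k)%R hn m0) (eK _ _ _ _ (yd _) kE').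
have [F' [F't F'y]] := J_lift hn m0 J1.
have [F [Ft Fy]] := J_lift hn m0 J2.
have FV (G H : groupType) (f : {multiplicative G -> H}) g : f g^-1 = (f g)^-1.
  by apply/esym/mulg1_eq; rewrite -gmulfM mulgV group_morph1.
apply: (@J_isomorphic _ _ F F') => -[].
- by rewrite Ft FV F't invgK.
- by rewrite Fy FV F'y invgK.
- by rewrite F't FV Ft invgK.
- by rewrite F'y FV Fy invgK.
Qed.

End JIsomorphisms.

Import GRing.Theory.
Local Open Scope ring_scope.

(** * Affine groups with cyclic linear part *)

(* The semidirect product of 'Z_d and R, where 1 : 'Z_d acts as multiplication
   by x; the proof that x ^+ d = 1 is part of the type. *)
Section CyclicAffineGroup.

Variables (R : comNzRingType) (d : nat) (x : R).
Hypothesis xd : x ^+ (Zp_trunc d).+2 = 1.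

Definition cyclic_affine of x ^+ (Zp_trunc d).+2 = 1 : Type := ('Z_d * R)%type.

Local Notation A := (cyclic_affine xd).

HB.instance Definition _ := Choice.copy A ('Z_d * R)%type.

Definition caff_mul (a b : A) : A := (a.1 + b.1, a.2 + x ^+ a.1 * b.2).
Definition caff_one : A := (0, 0).
Definition caff_inv (a : A) : A := (- a.1, - (x ^+ (- a.1) * a.2)).

(** The modulus of ['Z_d] is [(Zp_trunc d).+2] for every [d], which is why [xd] is stated with
    it. *)
Lemma exprZpD (a b : 'Z_d) : x ^+ (a + b)%R = x ^+ a * x ^+ b.
Proof. by rewrite -exprD /= expr_mod. Qed.

Lemma exprZpMn (a : 'Z_d) i : x ^+ (a *+ i)%R = (x ^+ a) ^+ i.
Proof.
by elim: i => [|i IHi]; rewrite ?mulr0n // mulrS exprZpD IHi -exprS.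
Qed.

Fact caff_mulA : associative caff_mul.
Proof.
by move=> a b c; congr (_, _); rewrite /= ?addrA // exprZpD mulrDr mulrA addrA.
Qed.

Fact caff_mul1g : left_id caff_one caff_mul.
Proof. by case=> a b; rewrite /caff_mul /= !add0r mul1r. Qed.

Fact caff_mulg1 : right_id caff_one caff_mul.
Proof. by case=> a b; rewrite /caff_mul /= mulr0 !addr0. Qed.

Fact caff_mulVg : left_inverse caff_one caff_inv caff_mul.
Proof. by case=> a b; rewrite /caff_mul /= !addNr. Qed.

Fact caff_mulgV : right_inverse caff_one caff_inv caff_mul.
Proof.
case=> a b; congr (_, _); first exact: addrN.
by rewrite /= mulrN mulrA -[X in _ - X * _](exprZpD a (- a)) subrr mul1r subrr.
Qed.

HB.instance Definition _ := isGroup.Build A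
  caff_mulA caff_mul1g caff_mulg1 caff_mulVg caff_mulgV.

Lemma caff_mulE (a b : A) : (a * b)%g = (a.1 + b.1, a.2 + x ^+ a.1 * b.2) :> A.
Proof. by []. Qed.

Lemma caff_mul_pair (e e' : 'Z_d) (c c' : R) :
  (((e, c) : A) * ((e', c') : A))%g = (e + e', c + x ^+ e * c') :> A.
Proof. by []. Qed.

Lemma caff_eq (a b : A) : a.1 = b.1 -> a.2 = b.2 -> a = b.
Proof. by case: a b => [a1 a2] [b1 b2] /= -> ->. Qed.

Lemma caff_exp1 (a : A) i : (a ^+ i)%g.1 = a.1 *+ i.
Proof. by elim: i => // i IHi; rewrite expgS caff_mulE /= IHi mulrS. Qed.

Lemma caff_translation (e : 'Z_d) i : (((e, 0) : A) ^+ i)%g = (e *+ i, 0).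
Proof.
elim: i => [|i IHi]; first by rewrite mulr0n.
by rewrite expgS IHi caff_mulE /= mulr0 addr0 mulrS.
Qed.

End CyclicAffineGroup.

Section JAffine.

Variables (n m : nat).
Hypothesis hn : n = 4%N \/ n = 6%N.
Hypothesis m0 : (0 < m)%N.

Let d1 : (1 < m * n)%N.
Proof. by case: hn => ->; lia. Qed.

Let Zp_eq0 i : (m * n %| i)%N -> i%:R = 0 :> 'Z_(m * n).
Proof. by move/dvdnP=> [q ->]; rewrite natrM pchar_Zp ?mulr0. Qed.

Variables (R : comNzRingType) (x : R).
Hypothesis xd : x ^+ (Zp_trunc (m * n)).+2 = 1.

Local Notation A := (cyclic_affine xd).

Definition caff_y : A := (1, 0).
(** The weight [7 * m] is the one that the relations force once y has weight 1; compare
    [weight_t]. *)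
Definition caff_t (c : R) : A := ((7 * m)%:R, c).

Lemma caff_exp2 (a : A) i :
  (a ^+ i)%g.2 = (\sum_(j < i) (x ^+ a.1) ^+ j) * a.2.
Proof.
elim: i => [|i IHi]; first by rewrite big_ord0 mul0r.
rewrite expgS caff_mulE /= IHi big_ord_recl expr0 mulrDl mul1r; congr (_ + _).
by rewrite mulrA mulr_sumr; congr (_ * _); apply: eq_bigr => j _; rewrite -exprS.
Qed.

Lemma caff_Jpair k c z : x ^+ (7 * m) = z ->
  (\sum_(j < n) z ^+ j) * c = 0 ->
  (1 + z + z ^+ 2) * c + z ^+ 3 * x ^+ k * (1 + z) * c = 0 ->
  Jpair n m k (caff_t c) caff_y.
Proof.
move=> zE hz hc; have xz : x ^+ ((7 * m)%:R : 'Z_(m * n)) = z.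
  by rewrite (exprZpMn xd) expr1.
split.
  apply: caff_eq; last by rewrite caff_exp2 /= xz.
  rewrite caff_exp1 /= -mulrnA Zp_eq0 //.
  by apply/dvdnP; exists 7; lia.
have t2 : (caff_t c ^+ 2)%g = ((7 * m)%:R *+ 2, (1 + z) * c) :> A.
  apply: caff_eq; first by rewrite caff_exp1.
  by rewrite caff_exp2 /= xz !big_ord_recl big_ord0 addr0.
have t3 : (caff_t c ^+ 3)%g = ((7 * m)%:R *+ 3, (1 + z + z ^+ 2) * c) :> A.
  apply: caff_eq; first by rewrite caff_exp1.
  by rewrite caff_exp2 /= xz !big_ord_recl big_ord0 addr0 addrA.
rewrite t2 t3 !caff_translation !caff_mul_pair; congr (_, _).
  (* The weights of the two sides differ by (7 * 3 + 7 * 2 + 1) m = 36 m, a multiple of m n. *)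
  rewrite -!mulrnA -!natrD -[RHS]addr0 -(@Zp_eq0 (36 * m)%N) -?natrD.
    by congr _%:R; lia.
  by case: hn => ->; apply/dvdnP; [exists 9 | exists 6]; lia.
rewrite !mulr0 !addr0 (exprZpD xd) !(exprZpMn xd) expr1 zE /= -[RHS]hc.
by ring.
Qed.

End JAffine.

Lemma Zp_nat_eq d i j : (1 < d)%N -> i%:R = j%:R :> 'Z_d -> i = j %[mod d].
Proof. by move=> d1 /(congr1 val); rewrite /= !val_Zp_nat. Qed.

(** * Weights of a homomorphism to an affine group *)

Section AffineImage.

Variables (n m1 m2 : nat).
Hypothesis hn : n = 4%N \/ n = 6%N.
Hypotheses (m10 : (0 < m1)%N) (m20 : (0 < m2)%N).
Variables (k1 : int) (R : comNzRingType) (x : R).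
Hypothesis xd : x ^+ (Zp_trunc (m2 * n)).+2 = 1.
Variable F : {multiplicative J n m1 k1 -> cyclic_affine xd}.

Local Notation t := (J_of n m1 k1 J_t).
Local Notation y := (J_of n m1 k1 J_y).
Let K1 := `|(k1 %% (m1 * n)%N)%Z|%N.
Let wt g := (F g).1.
Let s : 'Z_(m2 * n) := wt y.

Let wtM g h : wt (g * h)%g = wt g + wt h.
Proof. by rewrite /wt gmulfM. Qed.

Let wtX g i : wt (g ^+ i)%g = wt g *+ i.
Proof. by rewrite /wt group_morphX caff_exp1. Qed.

Let wt1 : wt 1%g = 0.
Proof. by rewrite /wt group_morph1. Qed.

(** The relations give n wt(t) = 0 and 5 wt(t) = - m1 s. Multiply the latter by 7 and use that n
    divides 36. *)
Lemma weight_t : wt t = s *+ (7 * m1).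
Proof.
have [tn e] := Jpair_J k1 hn m10.
have := congr1 wt e; rewrite !wtM !wtX -/s => e1.
have w0 : wt t *+ n = 0 by rewrite -wtX tn wt1.
have w36 : wt t *+ 36 = 0.
  have /dvdnP[q ->] : (n %| 36)%N by case: hn => ->.
  by rewrite (mulnC q n) mulrnA w0 mul0rn.
have e2 : wt t *+ 5 + s *+ m1 = 0.
  apply: (addIr (s *+ K1)); rewrite add0r -[RHS]e1 (mulrnDr _ 3 2).
  by rewrite addrAC [_ + _ *+ 2 + _]addrAC.
have := congr1 (fun z => z *+ 7) e2; rewrite mul0rn mulrnDl -!mulrnA.
move/eqP; rewrite addrC addr_eq0 (mulnC m1) => /eqP ->.
by apply/eqP; rewrite -addr_eq0 -mulrS; apply/eqP.
Qed.

Lemma weight_multiple g : exists r, wt g = s *+ r.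
Proof.
move: g; apply: (J_ind hn m10) => [|g [r e]|g [r e]].
- by exists 0%N; rewrite wt1.
- by exists (7 * m1 + r)%N; rewrite wtM weight_t e (mulrnDr s (7 * m1)%N).
- by exists r.+1; rewrite wtM e mulrS.
Qed.

Hypothesis wt_onto : exists g, wt g = 1.

Lemma weight_unit : exists r, s *+ r = 1.
Proof. by have [g <-] := wt_onto; have [r ->] := weight_multiple g; exists r. Qed.

Let d1 : (1 < m2 * n)%N.
Proof. by case: hn => ->; lia. Qed.

(** [s] is a unit modulo m2 n, and it is killed by m1 n because y^(m1 n) = 1. *)
Lemma weight_dvdn : (m2 %| m1)%N.
Proof.
have [r sr] := weight_unit.
have n0 : (0 < n)%N by case: hn => ->.
rewrite -(dvdn_pmul2r n0).
have : (m1 * n)%:R = 0%:R :> 'Z_(m2 * n).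
  rewrite -{1}sr -mulrnA (mulnC r) mulrnA -wtX.
  by rewrite (J_order k1 hn m10) wt1 mul0rn.
by move/(Zp_nat_eq d1)/eqP; rewrite mod0n.
Qed.

End AffineImage.

(** * Fox values and their forced vanishing *)

(* Eliminating x from the equations x^m = w^-5 = w^7 and
   x^k w^3 (1 + w) = -(1 + w + w^2), which say that t := (v |-> w v + 1) and
   y := (v |-> x v) satisfy the relations of J_n(m,k). *)
Definition fox_value (R : comNzRingType) (m k : nat) (w : R) : R :=
  w ^+ (7 * k) * (w ^+ 3 * (1 + w)) ^+ m - (- (1 + w + w ^+ 2)) ^+ m.

Section TwistedImage.

Variables (n m : nat).
Hypothesis hn : n = 4%N \/ n = 6%N.
Hypothesis m0 : (0 < m)%N.
Variables (k : int) (R : comNzRingType) (x z : R).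
Hypothesis xd : x ^+ (Zp_trunc (m * n)).+2 = 1.
Hypotheses (zn : z ^+ n = 1) (xm : x ^+ m = z ^+ 7).
Hypothesis z7_unit : exists v, (z ^+ 7 - 1) * v = 1.
Variable F : {multiplicative J n m k -> cyclic_affine xd}.
Hypothesis F_weight : exists g, (F g).1 = 1.
Hypothesis F_translation : exists g, F g = ((0, 1) : cyclic_affine xd).

Local Notation t := (J_of n m k J_t).
Local Notation y := (J_of n m k J_y).
Let K := `|(k %% (m * n)%N)%Z|%N.
Let s := (F y).1.
Let X := x ^+ s.
Let Z := z ^+ s.

Let d1 : (1 < m * n)%N.
Proof. by case: hn => ->; lia. Qed.

Let Xm : X ^+ m = Z ^+ 7.
Proof. by rewrite /X /Z -exprM mulnC exprM xm -!exprM mulnC. Qed.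

Let z48 i : z ^+ (48 * i) = 1.
Proof.
have /dvdnP[q ->] : (n %| 48)%N by case: hn => ->.
by rewrite (mulnC q) -mulnA exprM zn expr1n.
Qed.

Let Lt : x ^+ (F t).1 = Z.
Proof.
rewrite (weight_t hn m0 F) (exprZpMn xd) -/s -/X mulnC exprM Xm -exprM /Z -exprM.
(* 7 is its own inverse modulo n, as n divides 48. *)
by rewrite mulnC (_ : 7 * 7 = 48 + 1)%N // mulnDl exprD z48 mul1r mul1n.
Qed.

(** X - 1 divides x - 1, as x is a power of X, and x - 1 divides the unit x^m - 1 = z^7 - 1. *)
Let X1_unit : exists v, (X - 1) * v = 1.
Proof.
have [r sr] := weight_unit hn m0 F_weight.
have xX : x = X ^+ r by rewrite /X -(exprZpMn xd) sr expr1.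
have [v zv] := z7_unit.
exists ((\sum_(i < r) X ^+ i) * (\sum_(i < m) x ^+ i) * v).
by rewrite !mulrA -subrX1 -xX -subrX1 xm.
Qed.

(** [s] is a unit modulo m n, hence modulo n, and the only units modulo 4 or 6 are 1 and -1. *)
Lemma weight_residue : s = 1 %[mod n] \/ s = n.-1 %[mod n].
Proof.
have [r sr] := weight_unit hn m0 F_weight.
have sr1 : (s * r = 1 %[mod n])%N.
  have : (s * r)%:R = 1%:R :> 'Z_(m * n).
    by rewrite natrM natr_Zp mulr_natr sr.
  move/(Zp_nat_eq d1) => e.
  have nd : (n %| m * n)%N by apply: dvdn_mull.
  by rewrite -(modn_dvdm (s * r)%N nd) e (modn_dvdm 1%N nd).
have : (s %% n * (r %% n) = 1 %[mod n])%N by rewrite modnMm.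
have n0 : (0 < n)%N by case: hn => ->.
have n1 : (1 %% n = 1)%N by case: hn => ->.
have nV : (n.-1 %% n = n.-1)%N by case: hn => ->.
rewrite n1 nV; move: (ltn_pmod s n0) (ltn_pmod r n0).
move: (s %% n)%N (r %% n)%N => a b.
clear -hn; case: hn => ->.
  by do 4?[case: a => [|a]] => //; do 4?[case: b => [|b]] => //; auto.
by do 6?[case: a => [|a]] => //; do 6?[case: b => [|b]] => //; auto.
Qed.

(** Since X - 1 is a unit, F y may be assumed to fix the origin. All translation parts are then
    multiples of that of F t, which is a unit because translation by 1 is in the image. Cancelling
    it from the relation gives an equation for X^K, whose m-th power eliminates X. *)
Lemma fox_value_weight : fox_value m K Z = 0.
Proof.
have [v Xv] := X1_unit.
pose b := (F y).2 * v.
pose C g := (F g).2 - (x ^+ (F g).1 - 1) * b.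
pose a := C t.
have wM g1 g2 : x ^+ (F (g1 * g2)%g).1 = x ^+ (F g1).1 * x ^+ (F g2).1.
  by rewrite gmulfM (exprZpD xd).
(* C is the translation cocycle minus the coboundary making it vanish at y. *)
have CM g h : C (g * h)%g = C g + x ^+ (F g).1 * C h.
  by rewrite /C wM gmulfM caff_mulE [(_, _).2]/=; ring.
have Cy : C y = 0.
  by rewrite /C -/s -/X /b mulrCA Xv mulr1 subrr.
have C1 : C 1%g = 0 by rewrite /C group_morph1 /= expr0 subrr mul0r subrr.
have Cyi i : C (y ^+ i)%g = 0.
  by elim: i => // i IHi; rewrite expgS CM Cy IHi mulr0 addr0.
have aq g : exists q, C g = a * q.
  move: g; apply: (J_ind hn m0) => [|g [q e]|g [q e]].
  - by exists 0; rewrite C1 mulr0.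
  - by exists (1 + Z * q); rewrite CM Lt e -/a; ring.
  - by exists (X * q); rewrite CM Cy -/s -/X e; ring.
have [g Fg] := F_translation; have [q] := aq g.
rewrite /C Fg /= expr0 subrr mul0r subr0 => aq1.
have [tn e] := Jpair_J k hn m0.
have wX (h : J n m k) i : x ^+ (F (h ^+ i)%g).1 = (x ^+ (F h).1) ^+ i.
  by rewrite group_morphX caff_exp1 (exprZpMn xd).
have Ct2 : C (t ^+ 2)%g = (1 + Z) * a.
  by rewrite expg2 CM Lt -/a; ring.
have Ct3 : C (t ^+ 3)%g = (1 + Z + Z ^+ 2) * a.
  by rewrite expgS CM Lt Ct2 -/a; ring.
have := congr1 C e.
rewrite (CM _ (y ^+ m)%g) (CM _ (t ^+ 2)%g) (CM (t ^+ 3)%g) !Cyi Ct2 Ct3.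
rewrite (wM _ (t ^+ 2)%g) (wM (t ^+ 3)%g) !wX Lt -/s -/X => rel.
have {}rel : Z ^+ 3 * (1 + Z) * X ^+ K = - (1 + Z + Z ^+ 2).
  apply/eqP; rewrite -addr_eq0; apply/eqP.
  rewrite -[LHS]mulr1 [X in _ * X]aq1 mulrA -[RHS](mul0r q); congr (_ * _).
  by rewrite -rel; ring.
rewrite /fox_value -rel; move: (Z ^+ 3 * (1 + Z)) => A.
by rewrite exprMn -(exprM X) (mulnC K m) (exprM X m K) Xm -exprM mulrC subrr.
Qed.

End TwistedImage.

(** * Affine representations from a zero of the Fox value *)

(** From u m = v k + 1, the common root is h^u g^-v. *)
Lemma common_root (R : comNzRingType) (m k : nat) (h g g' : R) :
    (0 < m)%N -> coprime m k -> g * g' = 1 -> g ^+ m = h ^+ k ->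
  exists x, x ^+ m = h /\ x ^+ k = g.
Proof.
move=> m0 mk gg' gh; case: (egcdnP k m0) => u v; rewrite (eqP mk) addn1 => uv _.
exists (h ^+ u * g' ^+ v); split; rewrite exprMn -!exprM.
  rewrite uv exprSr mulrAC (mulnC v k) exprM -gh (mulnC v m) exprM -exprMn.
  by rewrite -exprMn gg' !expr1n mul1r.
rewrite (mulnC u) exprM -gh -exprM (mulnC m) uv exprSr mulrAC -exprMn gg'.
by rewrite expr1n mul1r.
Qed.

Section ScalingElement.

Variables (n m k : nat) (R : comNzRingType) (z : R).
Hypothesis hn : n = 4%N \/ n = 6%N.
Hypothesis hz : z ^+ 2 = (n == 6%N)%:R * z - 1.

Let A := z ^+ 3 * (1 + z).
Let B := - (1 + z + z ^+ 2).

Let hz46 : n = 4%N /\ z ^+ 2 = -1 \/ n = 6%N /\ z ^+ 2 = z - 1.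
Proof. by case: hn hz => -> /= ->; [left | right]; split=> //; ring. Qed.

Let z3 : n = 4%N /\ z ^+ 3 = - z \/ n = 6%N /\ z ^+ 3 = -1.
Proof.
case: hz46 => -[-> e]; [left | right]; split=> //; rewrite exprS e; first by ring.
by rewrite mulrBr -expr2 e; ring.
Qed.

Lemma root_order : z ^+ n = 1.
Proof.
case: hz46 z3 => -[-> e2] [] // [] // _ e.
  by rewrite (exprM z 2 2) e2 sqrrN expr1n.
by rewrite (exprM z 3 2) e sqrrN expr1n.
Qed.

Lemma root_sum : \sum_(j < n) z ^+ j = 0.
Proof.
case: z3 hz46 => -[-> e] [] // [] // _ e2; rewrite !big_ord_recl big_ord0 /= /bump /=.
  by rewrite !add1n e e2; ring.
by rewrite !add1n (exprD z 3 1) (exprD z 3 2) e; ring.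
Qed.

(** A and B come from elements of coprime norms in Z[w]: 1 - w and -w, of norms 2 and 1, for n = 4;
    -(1 + w) and -2 w, of norms 3 and 4, for n = 6. *)
Let comaximal : exists p q, p * A + q * B = 1.
Proof.
rewrite /A /B; case: z3 hz46 => -[-> e] [] // [] // _ e2; rewrite e e2.
  exists 0, z; transitivity (- z ^+ 2); first by ring.
  by rewrite e2 opprK.
exists (z - 2), (1 - z); transitivity (z ^+ 2 - z + 2); first by ring.
by rewrite e2; ring.
Qed.

Hypothesis m0 : (0 < m)%N.
Hypothesis fox0 : fox_value m k z = 0.
Hypothesis mk : coprime m k.

Let h := z ^+ 7.

Let foxE : B ^+ m = h ^+ k * A ^+ m.
Proof. by apply/esym/eqP; rewrite -subr_eq0 -exprM; apply/eqP/fox0. Qed.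

Let hV : h ^+ n = 1.
Proof. by rewrite -exprM mulnC exprM root_order expr1n. Qed.

(** Modulo [a], q b = 1 while b^m = 0, so [a] generates the unit ideal. Factoring (q b)^m - 1 makes
    the inverse explicit. *)
Let comaximal_unit (a b p q c : R) :
  p * a + q * b = 1 -> b ^+ m = c * a ^+ m -> exists a', a * a' = 1.
Proof.
move=> pq bc.
have e : q * b - 1 = - (p * a) by rewrite -pq; ring.
have := subrX1 (q * b) m; rewrite e exprMn bc.
set S := \sum_(i < _) _ => eS.
exists (q ^+ m * c * a ^+ m.-1 + p * S).
have am : a ^+ m = a * a ^+ m.-1 by rewrite -exprS prednK.
have -> : a * (q ^+ m * c * a ^+ m.-1 + p * S) =
    q ^+ m * (c * a ^+ m) - - (p * a) * S by rewrite am; ring.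
by rewrite -eS; ring.
Qed.

Let A_unit : exists a, A * a = 1.
Proof. by have [p [q pq]] := comaximal; apply: comaximal_unit pq foxE. Qed.

Let B_unit : exists b, B * b = 1.
Proof.
have [p [q pq]] := comaximal; rewrite addrC in pq.
apply: (comaximal_unit (c := h ^+ (k * n.-1)) pq).
rewrite foxE mulrA -exprD -mulnSr prednK; last by case: hn => ->.
by rewrite mulnC exprM hV expr1n mul1r.
Qed.

(** Vanishing of the Fox value makes A and B units with (B / A)^m = h^k, so [common_root]
    applies. *)
Lemma scaling_element : exists x, x ^+ m = h /\ x ^+ k * A = B.
Proof.
have [[a Aa] [b Bb]] := (A_unit, B_unit).
have g1 : (B * a) * (A * b) = 1.
  by transitivity ((A * a) * (B * b)); [ring | rewrite Aa Bb mulr1].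
have gm : (B * a) ^+ m = h ^+ k.
  by rewrite exprMn foxE -mulrA -exprMn Aa expr1n mulr1.
have [x [xm xk]] := common_root m0 mk g1 gm.
by exists x; split=> //; rewrite xk -mulrA (mulrC a) Aa mulr1.
Qed.

(** For n = 6, z^7 - 1 = z - 1 = z^2. For n = 4, z^7 - 1 = -(1 + z), and the equation for x^k
    reduces to x^k (1 + z) = 1. *)
Lemma scaling_unit x : x ^+ k * A = B -> exists v, (z ^+ 7 - 1) * v = 1.
Proof.
rewrite /A /B; case: z3 hz46 => -[-> e] [] // [] // _ e2.
  rewrite (exprD z 3 4) (exprD z 2 2) e e2 => xk; exists (- x ^+ k).
  transitivity (z * (x ^+ k * (- z * (1 + z))) + x ^+ k * (1 + z) * (z ^+ 2 + 1)).
    by ring.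
  by rewrite xk e2; transitivity (- z ^+ 2); [ring | rewrite e2 opprK].
rewrite (exprD z 3 4) (exprD z 3 1) e => _; exists (- z).
transitivity (z - z ^+ 2); first by ring.
by rewrite e2; ring.
Qed.

End ScalingElement.

(** A zero for [k2] gives an affine representation of the second group; pulled back along the
    isomorphism, it satisfies the hypotheses of [fox_value_weight] for [k1]. *)
Lemma fox_value_transfer (n m : nat) (k1 k2 : int) (R : comNzRingType) (z : R) :
    n = 4%N \/ n = 6%N -> (0 < m)%N -> gcdz m k2 = 1 ->
    z ^+ 2 = (n == 6%N)%:R * z - 1 ->
    fox_value m `|(k2 %% (m * n)%N)%Z|%N z = 0 ->
    isomorphic (J n m k1) (J n m k2) ->
  fox_value m `|(k1 %% (m * n)%N)%Z|%N z = 0 \/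
  fox_value m `|(k1 %% (m * n)%N)%Z|%N (z ^+ n.-1) = 0.
Proof.
move=> hn m0 mk hz fox2 [f [f' _ f'K]].
have [x [xm xk]] := scaling_element hn hz m0 fox2 (coprime_residue n mk).
have zn := root_order hn hz.
have d1 : (1 < m * n)%N by case: hn => ->; lia.
have xd : x ^+ (Zp_trunc (m * n)).+2 = 1.
  by rewrite Zp_cast // exprM xm -exprM mulnC exprM zn expr1n.
have z7m : x ^+ (7 * m) = z.
  rewrite mulnC exprM xm -exprM (exprD z 1 48).
  have /dvdnP[q ->] : (n %| 48)%N by case: hn => ->.
  by rewrite (mulnC q n) exprM zn expr1n mulr1.
have sum0 : (\sum_(j < n) z ^+ j) * 1 = 0 by rewrite root_sum ?mul0r.
have rel : (1 + z + z ^+ 2) * 1 +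
    z ^+ 3 * x ^+ `|(k2 %% (m * n)%N)%Z|%N * (1 + z) * 1 = 0.
  rewrite !mulr1 (mulrC (z ^+ 3)) -mulrA.
  by rewrite xk addrN.
have [rho [rho_t rho_y]] := J_lift hn m0 (caff_Jpair hn m0 xd z7m sum0 rel).
pose F : {multiplicative J n m k1 -> cyclic_affine xd} := rho \o f.
have F_weight : exists g, (F g).1 = 1.
  by exists (f' (J_of n m k2 J_y)); rewrite /= f'K rho_y.
have F_translation : exists g, F g = ((0, 1) : cyclic_affine xd).
  (* The exponent 29 m brings the weight 7 m of t to 36 m = 0 and leaves the translation part 1. *)
  exists (f' (J_of n m k2 J_t * J_of n m k2 J_y ^+ (29 * m))%g).
  rewrite /= f'K gmulfM group_morphX rho_y rho_t caff_translation caff_mul_pair.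
  rewrite mulr0 addr0 -natrD; congr (_, _).
  have /dvdnP[q ->] : (m * n %| 7 * m + 29 * m)%N.
    by rewrite -mulnDl (mulnC _ m) dvdn_pmul2l //; case: hn => ->.
  by rewrite natrM pchar_Zp ?mulr0.
have [v zv] := scaling_unit hn hz xk.
have := fox_value_weight hn m0 zn xm (ex_intro _ v zv) F_weight F_translation.
have z_mod i j : i = j %[mod n] -> z ^+ i = z ^+ j.
  by move=> ij; rewrite -(expr_mod i zn) ij expr_mod.
by case: (weight_residue hn m0 F_weight) => /z_mod ->; [left | right].
Qed.

(** * Principal quotients and quadratic integer rings *)

(** For a non-unit [a] the ring D/(a) is nonzero, as [comNzRingType] demands. *)
Lemma principal_quotient (D : comNzRingType) (a : D) :
    ~ (exists q, 1 = q * a) ->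
  exists (R : comNzRingType) (p : {rmorphism D -> R}),
    forall u, p u = 0 <-> exists q, u = q * a.
Proof.
move=> a_unit; pose S : {pred D} := fun u => `[< exists q, u = q * a >].
have SP u : reflect (exists q, u = q * a) (u \in S) by apply: asboolP.
have S_ideal : idealr_closed S.
  split; first by apply/SP; exists 0; rewrite mul0r.
    by apply/SP.
  move=> b u v /SP[p ->] /SP[q ->]; apply/SP; exists (b * p + q); ring.
pose I : idealr D := HB.pack S (isIdealr.Build D S S_ideal).
exists {ideal_quot I}, (\pi_({ideal_quot I})%qT) => u.
have e : (u \in I) = (\pi_({ideal_quot I})%qT u == 0).
  by rewrite -[in LHS](subr0 u) Quotient.idealrBE (rmorph0 (\pi_({ideal_quot I})%qT)).
by split=> [/eqP|/SP]; [rewrite -e => /SP | rewrite [_ \in S]e => /eqP].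
Qed.

(* The pair (a, b) stands for a + b w, where w ^+ 2 = e w - 1; e is a phantom
   parameter. *)
Definition quadint (e : int) : Type := let: _ := e in (int * int)%type.

Section QuadraticIntegers.

Variable e : int.
Local Notation D := (quadint e).

HB.instance Definition _ := GRing.Zmodule.copy D (int * int)%type.

Definition quad_mul (u v : D) : D :=
  (u.1 * v.1 - u.2 * v.2, u.1 * v.2 + u.2 * v.1 + e * u.2 * v.2).
Definition quad_one : D := (1, 0).

Fact quad_mulA : associative quad_mul.
Proof. by move=> [a b] [c d] [f g]; congr (_, _) => /=; ring. Qed.

Fact quad_mulC : commutative quad_mul.
Proof. by move=> [a b] [c d]; congr (_, _) => /=; ring. Qed.

Fact quad_mul1 : left_id quad_one quad_mul.
Proof. by move=> [a b]; congr (_, _) => /=; ring. Qed.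

Fact quad_mulDl : left_distributive quad_mul +%R.
Proof. by move=> [a b] [c d] [f g]; congr (_, _) => /=; ring. Qed.

Fact quad_one_neq0 : quad_one != 0.
Proof. by []. Qed.

HB.instance Definition _ := GRing.Zmodule_isComNzRing.Build D
  quad_mulA quad_mulC quad_mul1 quad_mulDl quad_one_neq0.

Definition quad_root : D := (0, 1).
Definition quad_conj (u : D) : D := (u.1 + e * u.2, - u.2).
Definition quad_trace (u : D) : int := 2 * u.1 + e * u.2.
Definition quad_norm (u : D) : int := u.1 ^+ 2 + e * u.1 * u.2 + u.2 ^+ 2.

Fact quad_conj_is_zmod_morphism : zmod_morphism quad_conj.
Proof. by move=> [a b] [c d]; congr (_, _) => /=; ring. Qed.

HB.instance Definition _ :=
  GRing.isZmodMorphism.Build D D quad_conj quad_conj_is_zmod_morphism.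

Fact quad_conj_is_monoid_morphism : monoid_morphism quad_conj.
Proof.
split; first by congr (_, _) => /=; ring.
by move=> [a b] [c d]; congr (_, _) => /=; ring.
Qed.

HB.instance Definition _ :=
  GRing.isMonoidMorphism.Build D D quad_conj quad_conj_is_monoid_morphism.

Lemma quad_normM (u v : D) : quad_norm (u * v) = quad_norm u * quad_norm v.
Proof. by case: u v => [a b] [c d]; rewrite /quad_norm /=; ring. Qed.

Lemma quad_norm1 : quad_norm 1 = 1.
Proof. by rewrite /quad_norm /=; ring. Qed.

Lemma quad_normX (u : D) i : quad_norm (u ^+ i) = quad_norm u ^+ i.
Proof.
by elim: i => [|i IHi]; rewrite ?quad_norm1 // !exprS quad_normM IHi.
Qed.

Lemma quad_norm_conj (u : D) : quad_norm (quad_conj u) = quad_norm u.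
Proof. by case: u => [a b]; rewrite /quad_norm /=; ring. Qed.

(** The law of cosines, through which norms of Fox values become traces. *)
Lemma quad_normB (u v : D) : quad_norm (u - v) =
  quad_norm u + quad_norm v - quad_trace (u * quad_conj v).
Proof. by case: u v => [a b] [c d]; rewrite /quad_norm /quad_trace /=; ring. Qed.

Lemma quad_traceMn (u : D) c : quad_trace (u *+ c) = quad_trace u *+ c.
Proof.
elim: c => [|c IHc]; first by rewrite !mulr0n /quad_trace /= !mulr0.
rewrite !mulrS -IHc; move: (u *+ c) => v {IHc}.
by case: u v => [a b] [f g]; rewrite /quad_trace /=; ring.
Qed.

End QuadraticIntegers.

Lemma rmorph_fox_value (R S : comNzRingType) (f : {rmorphism R -> S}) m k w :
  f (fox_value m k w) = fox_value m k (f w).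
Proof.
by rewrite /fox_value !(rmorphB, rmorphM, rmorphXn, rmorphN, rmorphD, rmorph1).
Qed.

(** * Norms of Fox values in the Gaussian and Eisenstein integers *)

Section FoxNorm.

Variables (n m : nat).
Hypothesis hn : n = 4%N \/ n = 6%N.

Local Notation D := (quadint (n == 6%N)).
Let w : D := quad_root _.

Lemma quad_root_sqr : w ^+ 2 = (n == 6%N)%:R * w - 1.
Proof. by case: hn => ->. Qed.

Lemma quad_rootX : w ^+ n = 1.
Proof. exact: root_order hn quad_root_sqr. Qed.

Lemma quad_conj_root : quad_conj w = w ^+ n.-1.
Proof. by rewrite /w; case: hn => ->. Qed.

Definition fox_norm k : int := quad_norm (fox_value m k w).

Lemma fox_norm_ge0 k : 0 <= fox_norm k.
Proof.
rewrite /fox_norm; case: (fox_value m k w) => a b; rewrite /quad_norm /=.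
by case: hn => -> /=; nia.
Qed.

Let W : D := w ^+ 3 * (1 + w) * quad_conj (- (1 + w + w ^+ 2)).

(** As w has norm 1, only the trace term in the norm of the difference depends on k. *)
Lemma fox_norm_eq_trace k1 k2 : fox_norm k1 = fox_norm k2 ->
  quad_trace (w ^+ (7 * k1) * W ^+ m) = quad_trace (w ^+ (7 * k2) * W ^+ m).
Proof.
rewrite /fox_norm /fox_value !quad_normB !quad_normM.
have N1 i : quad_norm (w ^+ i) = 1.
  by rewrite quad_normX (_ : quad_norm w = 1) ?expr1n // /quad_norm /=; ring.
have WE i : w ^+ i * W ^+ m =
    w ^+ i * (w ^+ 3 * (1 + w)) ^+ m * quad_conj ((- (1 + w + w ^+ 2)) ^+ m).
  rewrite (rmorphXn (@quad_conj _)) /W.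
  rewrite exprMn mulrA; reflexivity.
by rewrite !N1 !WE => h; apply: oppr_inj (addrI _ h).
Qed.

Let q := m./2.
Let r : nat := odd m.

Lemma quad_trace_period (j c i : nat) : W ^+ 2 = w ^+ j *+ c ->
  quad_trace (w ^+ i * W ^+ m) =
    quad_trace (w ^+ ((i + j * q) %% n) * W ^+ r) *+ c ^ q.
Proof.
move=> W2; rewrite -[in LHS](odd_double_half m) -/q -/r exprD -mul2n exprM W2.
rewrite exprMn_n -exprM -quad_traceMn (expr_mod _ quad_rootX) exprD.
by congr quad_trace; rewrite !mulrnAr mulrA mulrAC.
Qed.

(** The trace is twice the real part, and W has argument pi/4 for n = 4 and -pi/6 for n = 6. Equal
    cosines mean equal or opposite angles; the finitely many cases are computed. *)
Lemma quad_trace_residue (i1 i2 : nat) : (i1 < n)%N -> (i2 < n)%N ->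
    quad_trace (w ^+ i1 * W ^+ r) = quad_trace (w ^+ i2 * W ^+ r) ->
  i1 = i2 \/ (i1 + i2 + (if n == 4%N then r else n - r))%N = 0 %[mod n].
Proof.
have check (b : bool) : all (fun a1 => all (fun a2 =>
    (quad_trace (w ^+ a1 * W ^+ b) == quad_trace (w ^+ a2 * W ^+ b)) ==>
    ((a1 == a2) || ((a1 + a2 + (if n == 4%N then b : nat else n - b)) %% n == 0)%N))
    (iota 0 n)) (iota 0 n).
  by rewrite /W /w; case: b; case: hn => ->; vm_compute.
move=> lt1 lt2 e.
have /allP/(_ i1) := check (odd m); rewrite mem_iota => /(_ lt1).
move/allP/(_ i2); rewrite mem_iota => /(_ lt2); rewrite e eqxx /=.
by case/orP=> /eqP; [left | right; rewrite mod0n].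
Qed.

Lemma fox_norm_inj k1 k2 : fox_norm k1 = fox_norm k2 ->
  (k1 = k2 %[mod n])%N \/ (k1 + k2 = m %[mod n])%N.
Proof.
move=> /fox_norm_eq_trace.
have [j [c [c0 W2 jE]]] : exists j c, [/\ (0 < c)%N, W ^+ 2 = w ^+ j *+ c
    & j = (if n == 4%N then 1%N else 5%N)].
  (* W is 1 + w for n = 4 and 2 (1 + w^-1) for n = 6, with squares 2 w and 12 w^5. *)
  exists (if n == 4%N then 1%N else 5%N), (if n == 4%N then 2%N else 12%N).
  by rewrite /W /w; case: hn => ->.
rewrite !(quad_trace_period _ W2) => /(Num.Theory.pmulrnI _) e.
have n0 : (0 < n)%N by case: hn => ->.
have {e} := e _; rewrite expn_gt0 c0 => /(_ isT).
move/(quad_trace_residue (ltn_pmod _ n0) (ltn_pmod _ n0)).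
(* As 7 is -1 modulo 4 and 1 modulo 6, the case of opposite angles reads k1 + k2 = 2 q + r = m
   modulo n. *)
have := odd_double_half m; rewrite -/q -/r jE.
clear -hn; case: hn => -> /=; lia.
Qed.

End FoxNorm.

(** * Invariants of the isomorphism class and the classification *)

(** In D/(a), with [a] the Fox value for [k2], the transfer shows that [a] divides the Fox value for
    [k1] or its conjugate, and conjugates have equal norms. If [a] is a unit, so is its norm. *)
Lemma fox_norm_dvd (n m : nat) (k1 k2 : int) :
    n = 4%N \/ n = 6%N -> (0 < m)%N -> gcdz m k2 = 1 ->
    isomorphic (J n m k1) (J n m k2) ->
  (fox_norm n m `|(k2 %% (m * n)%N)%Z|%N %| fox_norm n m `|(k1 %% (m * n)%N)%Z|%N)%Z.
Proof.
move=> hn m0 mk iso; rewrite /fox_norm; set w := quad_root _.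
set a := fox_value m `|(k2 %% _)%Z|%N w; set b := fox_value m _ w.
have [[q e]|a_unit] := pselect (exists q, 1 = q * a).
  apply/dvdzP; exists (quad_norm b * quad_norm q).
  have := congr1 (@quad_norm _) e; rewrite quad_norm1 quad_normM => e1.
  by rewrite -mulrA -e1 mulr1.
have [R [p pP]] := principal_quotient a_unit.
have hz : p w ^+ 2 = (n == 6%N)%:R * p w - 1.
  by rewrite -rmorphXn quad_root_sqr // rmorphB rmorphM rmorph_nat rmorph1.
have pa : p a = 0 by apply/pP; exists 1; rewrite mul1r.
have dvd c : p c = 0 -> (quad_norm a %| quad_norm c)%Z.
  by case/pP=> q ->; rewrite quad_normM dvdz_mull.
rewrite (rmorph_fox_value p) in pa.
case: (fox_value_transfer hn m0 mk hz pa iso); first by rewrite -rmorph_fox_value => /dvd.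
rewrite -rmorphXn -quad_conj_root // -rmorph_fox_value -(rmorph_fox_value (@quad_conj _)).
by move=> /dvd; rewrite quad_norm_conj.
Qed.

Lemma isomorphic_sym (G H : groupType) : isomorphic G H -> isomorphic H G.
Proof.
move=> [f [g fK gK]].
pose g' := isMultiplicative.Build H G g (can2_gmulfM fK gK).
pose gM : {multiplicative H -> G} := HB.pack g g'.
by exists gM, f.
Qed.

Lemma isomorphic_trans (G H L : groupType) :
  isomorphic G H -> isomorphic H L -> isomorphic G L.
Proof.
by move=> [f bf] [g bg]; exists (g \o f); apply: bij_comp.
Qed.

(** With x = 1 and translation part 0 the affine representation reduces to the weight map onto Z/(m2
    n), to which [weight_dvdn] applies. *)
Lemma isomorphic_dvdn (n m1 m2 : nat) (k1 k2 : int) :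
    n = 4%N \/ n = 6%N -> (0 < m1)%N -> (0 < m2)%N ->
  isomorphic (J n m1 k1) (J n m2 k2) -> (m2 %| m1)%N.
Proof.
move=> hn m10 m20 [f [f' _ f'K]].
have xd : (1 : int) ^+ (Zp_trunc (m2 * n)).+2 = 1 by rewrite expr1n.
have h0 : (1 + 1 + 1 ^+ 2) * 0 +
    1 ^+ 3 * 1 ^+ `|(k2 %% (m2 * n)%N)%Z|%N * (1 + 1) * 0 = 0 :> int.
  by rewrite !mulr0 addr0.
have [rho [rho_t rho_y]] :=
  J_lift hn m20 (caff_Jpair hn m20 xd (expr1n _ _) (mulr0 _) h0).
pose F : {multiplicative J n m1 k1 -> cyclic_affine xd} := rho \o f.
apply: (weight_dvdn hn m10 m20 (F := F)).
by exists (f' (J_of n m2 k2 J_y)); rewrite /= f'K rho_y.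
Qed.

Lemma residue_eq (n m : nat) (k : int) : (0 < n)%N -> (0 < m)%N ->
  (`|(k %% (m * n)%N)%Z|%N%:Z = k %[mod n])%Z.
Proof.
move=> n0 m0; rewrite gez0_abs ?modz_ge0 //; last by lia.
rewrite {2}(divz_eq k (m * n)%N) PoszM mulrA.
by rewrite modzMDl.
Qed.

Local Close Scope ring_scope.
Local Close Scope group_scope.

Theorem theorem4 (n : nat) (hn : n = 4 \/ n = 6)
    (m1 m2 : int) (hm1 : (1 <= m1)%R) (hm2 : (1 <= m2)%R)
    (k1 k2 : int) (hk1 : gcdz m1 k1 = 1%R) (hk2 : gcdz m2 k2 = 1%R) :
  isomorphic (J n m1 k1) (J n m2 k2) <->
  m1 = m2 /\ ((k1 = k2 %[mod n])%Z \/ (k1 + k2 = m1 %[mod n])%Z).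
Proof.
have n0 : (0 < n)%N by case: hn => ->.
case: m1 hm1 hk1 => // m hm1 hk1; case: m2 hm2 hk2 => // m' hm2 hk2.
have m0 : (0 < m)%N by lia.
have m'0 : (0 < m')%N by lia.
split=> [iso | [[e] hk]]; last rewrite -e in hk2 *.
  have e : m = m'.
    apply/eqP; rewrite eqn_dvd.
    rewrite (isomorphic_dvdn hn _ _ iso) //.
    by rewrite (isomorphic_dvdn hn _ _ (isomorphic_sym iso)).
  rewrite -e in iso hk2 *; split=> //.
  have : fox_norm n m `|(k1 %% (m * n)%N)%Z|%N = fox_norm n m `|(k2 %% (m * n)%N)%Z|%N.
    have d12 := fox_norm_dvd hn m0 hk1 (isomorphic_sym iso).
    have d21 := fox_norm_dvd hn m0 hk2 iso.
    rewrite -[LHS]gez0_abs ?fox_norm_ge0 // -[RHS]gez0_abs ?fox_norm_ge0 //.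
    by congr Posz; apply/eqP; rewrite eqn_dvd; apply/andP; split; rewrite -dvdzE.
  have r1 := residue_eq k1 n0 m0; have r2 := residue_eq k2 n0 m0.
  case/(fox_norm_inj hn) => h; [left | right].
    by rewrite -r1 -r2 !modz_nat h.
  by rewrite -(modzDml k1) -r1 modzDml -modzDmr -r2 modzDmr -PoszD !modz_nat h.
case: hk => [k12 | k12]; first exact: J_isomorphic_mod.
(* The flip replaces k1 by m - k1, which is k2 modulo n. *)
apply: isomorphic_trans (J_isomorphic_flip hn m0 k1) _.
apply: (J_isomorphic_mod hn m0) => //.
  by rewrite -hk1 -[RHS]gcdzN -[RHS](gcdzMDl 1) mul1r.
apply/eqP; rewrite eqz_mod_dvd; move/eqP: k12; rewrite eqz_mod_dvd.
by move=> /dvdzP[q qE]; apply/dvdzP; exists (- q)%R; rewrite mulNr -qE; lia.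
Qed.
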